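(* Let $\rho$ and $\sigma$ be two density operators satisfying $m\rho\le\sigma\le M\rho$ with $0<m<M$, and let $-1\le p\le1$ with $p\ne0$. Then $$\frac{1-p}{2}\left(M^{p-2}-m^{p-2}\right)(M+m-Mm)+\frac{1-p}{2}\left(m^{p-2}-M^{p-2}\,Tr\left[\rho\left(\rho^{-1/2}\sigma\rho^{-1/2}\right)^2\right]\right)\le Tr\left[T_p(\rho|\sigma)\right]$$ and $$Tr\left[T_p(\rho|\sigma)\right]\le\frac{1-p}{2}\left(m^{p-2}-M^{p-2}\right)(M+m-Mm)+\frac{1-p}{2}\left(M^{p-2}-m^{p-2}\,Tr\left[\rho\left(\rho^{-1/2}\sigma\rho^{-1/2}\right)^2\right]\right).$$ Moreover, for $0<p\le1$, $$D_p(\rho|\sigma)\le\frac{1-p}{2}\left(m^{p-2}-M^{p-2}\right)(M+m-Mm)+\frac{1-p}{2}\left(M^{p-2}\,Tr\left[\rho\left(\rho^{-1/2}\sigma\rho^{-1/2}\right)^2\right]-m^{p-2}\right).$$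
   Context: A density operator is a strictly positive (positive and invertible) operator with unit trace, and $\le$ between operators is the Loewner order. For strictly positive $A$ and positive $B$, $A\natural_pB:=A^{1/2}\left(A^{-1/2}BA^{-1/2}\right)^pA^{1/2}$, and the Tsallis relative operator entropy is $T_p(A|B):=\frac{A\natural_pB-A}{p}$ for $-1\le p\le1$, $p\ne0$. The (quantum) Tsallis relative entropy is $D_p(\rho|\sigma):=\frac{Tr[\rho-\rho^{1-p}\sigma^p]}{p}$ for $|p|\le1$, $p\ne0$. *)

(* Defs.v *)
From HB Require Import structures.
From mathcomp Require Import all_boot all_order all_algebra.
From mathcomp Require Import complex.
From mathcomp Require Import reals exp.

Set Implicit Arguments.
Unset Strict Implicit.
Unset Printing Implicit Defensive.

Import Order.TTheory GRing.Theory Num.Theory.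
Local Open Scope ring_scope.
Local Open Scope complex_scope.
Local Open Scope sesquilinear_scope.

(* Operators are complex matrices: a trace class operator that is positive and
   invertible only exists on a finite-dimensional space.

   On R[i], x <= y means that x and y have the same imaginary part and that
   Re x <= Re y; in particular 0 <= x forces x to be real. *)

Section Operators.
Variables (R : realType) (n : nat).
Implicit Types (A B : 'M[R[i]]_n) (p : R).

(* Since the scalars are complex, this implies that A is Hermitian. *)
Definition positive_op A : Prop :=
  forall v : 'cV[R[i]]_n, 0 <= (v^t* *m A *m v) 0 0.

Definition strictly_positive_op A : Prop :=
  positive_op A /\ A \in unitmx.

Definition loewner_le A B : Prop := positive_op (B - A).

Definition density_op A : Prop :=
  strictly_positive_op A /\ \tr A = 1.

(* Functional calculus; meaningful for Hermitian A only, where spectralmx A is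
   unitary, spectral_diag A is real, and A is recovered for f := id. *)
Definition op_fun (f : R -> R) A : 'M[R[i]]_n :=
  invmx (spectralmx A)
    *m diag_mx (map_mx (fun x => (f (complex.Re x))%:C) (spectral_diag A))
    *m spectralmx A.

Definition op_pow A p : 'M[R[i]]_n := op_fun (fun x => x `^ p) A.

(* A^(-1/2) B A^(-1/2) *)
Definition op_ratio A B : 'M[R[i]]_n :=
  op_pow A (- 2^-1) *m B *m op_pow A (- 2^-1).

(* A natural_p B *)
Definition op_natural p A B : 'M[R[i]]_n :=
  op_pow A 2^-1 *m op_pow (op_ratio A B) p *m op_pow A 2^-1.

Definition tsallis_relative_op_entropy p A B : 'M[R[i]]_n :=
  (p^-1)%:C *: (op_natural p A B - A).

Definition tsallis_relative_entropy p A B : R[i] :=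
  \tr (A - op_pow A (1 - p) *m op_pow B p) / p%:C.

End Operators.

(* Main.v *)
Require Import Defs.
From mathcomp Require Import all_boot all_order all_algebra.
From mathcomp Require Import ring lra.
From mathcomp Require Import complex.
From mathcomp Require Import boolp classical_sets functions set_interval reals ereal.
From mathcomp Require Import topology normedtype sequences derive realfun exp convex.
From mathcomp Require Import measure lebesgue_measure lebesgue_integral ftc numfun.
From mathcomp Require Import measurable_realfun exponential_distribution.

(* Let X = rho^(-1/2) sigma rho^(-1/2), with spectrum in [m, M], and let
   tau f = Tr (rho f(X)). Then tau 1 = tau x = 1 and Tr T_p = tau ((x^p - 1) / p).
   The second derivative of (x^p - 1) / p lies between -(1 - p) m^(p - 2) and
   -(1 - p) M^(p - 2), so adding a suitable multiple of x^2 makes it convex or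
   concave on [m, M]. Applying tau to the bound by the chord, and evaluating the
   same bound at x = 1, gives two inequalities whose sum is the claim.

   The last part follows from the lower bound and from
   Tr (A #_p B) <= Tr (A^(1-p) B^p) for 0 < p <= 1. Since
   x^p = c \int_0^oo t^(p-1) x / (x + t) dt, it suffices to compare resolvents:
   Tr (A Y) <= Tr (A (X + t)^(-1)) where Y solves B Y + t Y A = A. *)

Set Implicit Arguments.
Unset Strict Implicit.
Unset Printing Implicit Defensive.

Import Order.TTheory GRing.Theory Num.Theory.
Import numFieldNormedType.Exports.
Local Open Scope ring_scope.
Local Open Scope complex_scope.

(** * Powers as integrals of resolvents *)

Section PowerIntegral.
Local Open Scope classical_set_scope.
Context {R : realType}.
Notation mu := (@lebesgue_measure R).
Variable p : R.
Hypotheses (p_gt0 : 0 < p) (p_lt1 : p < 1).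

(* [t^(p-1) / (1 + t) dt] after the substitution [t = exp s]. *)
Definition logistic_kernel (s : R) : R := expR (p * s) / (1 + expR s).

Local Notation k := logistic_kernel.

Lemma logistic_kernel_ge0 s : 0 <= k s.
Proof. by rewrite /k divr_ge0 ?addr_ge0 ?expR_ge0. Qed.

Lemma continuous_logistic_kernel : continuous k.
Proof.
move=> s.
apply: (@continuousM _ _ (fun s => expR (p * s)) (fun s => (1 + expR s)^-1)).
  apply: continuous_comp; last exact: continuous_expR.
  by apply: continuousM => //; exact: cst_continuous.
apply: continuousV; first by rewrite gt_eqF // ltr_pwDl // expR_ge0.
by apply: continuousD; [exact: cst_continuous | exact: continuous_expR].
Qed.

Lemma measurable_logistic_kernel : measurable_fun setT k.
Proof. by apply: continuous_measurable_fun; exact: continuous_logistic_kernel. Qed.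

(** The bound is 1/a times the exponential density of rate [a], whose integral is 1. It controls
    both tails of the kernel. *)
Lemma integral_le_expRN_lty (a : R) (f : R -> R) : 0 < a -> measurable_fun setT f ->
  (forall s, 0 <= f s) -> (forall s, 0 <= s -> f s <= expR (- a * s)) ->
  (\int[mu]_(s in `[0%R, +oo[) (f s)%:E < +oo)%E.
Proof.
move=> a0 mf f0 fle; have ma := @measurable_exponential_pdf R a.
apply: (@le_lt_trans _ _
  (\int[mu]_(s in `[0%R, +oo[) (a^-1%:E * (exponential_pdf a s)%:E))%E).
  apply: ge0_le_integral => //.
  - by move=> s _; rewrite lee_fin.
  - by apply/measurable_EFinP; apply: measurable_funTS.
  - apply/measurable_EFinP; apply: measurable_funTS.
    exact: measurable_funM.
  - move=> s; rewrite /= in_itv /= andbT => s0.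
    by rewrite -EFinM lee_fin exponential_pdfE // mulKf ?gt_eqF // fle.
rewrite ge0_integralZl_EFin //; last 3 first.
- by move=> s _; rewrite lee_fin exponential_pdf_ge0 // ltW.
- by apply/measurable_EFinP; apply: measurable_funTS.
- by rewrite invr_ge0 ltW.
rewrite lte_mul_pinfty ?lee_fin ?invr_ge0 1?ltW //.
apply: (@le_lt_trans _ _ 1%E); last exact: ltry.
rewrite -(integral_exponential_pdf a0); apply: ge0_subset_integral => //.
- by apply/measurable_EFinP.
- by move=> s _; rewrite lee_fin exponential_pdf_ge0 // ltW.
Qed.

(** The kernel is at most exp (p s) and at most exp (-(1 - p) s). The first bound decays on the left
    because 0 < p, the second on the right because p < 1. *)
Lemma integral_logistic_kernel_lty : (\int[mu]_s (k s)%:E < +oo)%E.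
Proof.
have mk := measurable_logistic_kernel; have k0 := logistic_kernel_ge0.
have mkE : measurable_fun setT (fun s => (k s)%:E) by exact/measurable_EFinP.
have mkN : measurable_fun setT (fun s : R => k (- s)).
  by apply: measurableT_comp.
have kexp s : k s <= expR (p * s).
  by rewrite ler_pdivrMr ?ltr_pwDl ?expR_ge0 // ler_peMr ?expR_ge0 // lerDl expR_ge0.
have kexpN s : k s <= expR (- (1 - p) * s).
  rewrite ler_pdivrMr ?ltr_pwDl ?expR_ge0 // mulrDr mulr1 -expRD.
  rewrite (_ : - (1 - p) * s + s = p * s); last by ring.
  by rewrite lerDr expR_ge0.
have -> : [set: R] = `]-oo, 0%R] `|` `]0%R, +oo[.
  by apply/seteqP; split => x //= _; rewrite !in_itv /= andbT; case: leP; [left | right].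
rewrite ge0_integral_setU //=; last 3 first.
- exact: measurable_funTS.
- by move=> s _; rewrite lee_fin.
- apply/disj_setPS => x /=; rewrite !in_itv /= andbT => -[x0].
  by rewrite ltNge x0.
(* Reflection turns the left tail into a right tail, where the exponential comparison applies. *)
have refl : (\int[mu]_(s in `]-oo, 0%R]) (k s)%:E
           = \int[mu]_(s in `[0%R, +oo[) (k (- s))%:E)%E.
  rewrite (@ge0_integration_by_substitution0 _ (fun s : R => (k (- s))%:E)).
  - by apply: eq_integral => s _; rewrite opprK.
  - exact/measurable_EFinP.
  - by move=> s; rewrite lee_fin.
apply: lte_add_pinfty.
  rewrite refl; apply: integral_le_expRN_lty p_gt0 mkN _ _ => [//|s _].
  by rewrite mulNr -mulrN kexp.
apply: (@le_lt_trans _ _ (\int[mu]_(s in `[0%R, +oo[) (k s)%:E)%E).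
  apply: ge0_subset_integral => //.
  - exact: measurable_funTS.
  - by move=> s _; rewrite lee_fin.
  - by move=> s /=; rewrite !in_itv /= !andbT => /ltW.
by apply: (@integral_le_expRN_lty (1 - p)); rewrite ?subr_gt0.
Qed.

(** On [0, 1] the numerator is at least 1 and the denominator at most 1 + e. Being positive and
    finite, this integral can later be cancelled. *)
Lemma integral_logistic_kernel_gt0 : (0 < \int[mu]_s (k s)%:E)%E.
Proof.
have mk := measurable_logistic_kernel; have k0 := logistic_kernel_ge0.
have mkE : measurable_fun setT (fun s => (k s)%:E) by exact/measurable_EFinP.
apply: (@lt_le_trans _ _ (\int[mu]_(s in `[0%R, 1%R]) (cst (1 + expR 1)^-1%:E s))%E).
  rewrite integral_cst //= lebesgue_measure_itv /= lte_fin ltr01 oppr0 adde0 mule1.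
  by rewrite lte_fin invr_gt0 ltr_pwDl ?expR_ge0.
apply: (@le_trans _ _ (\int[mu]_(s in `[0%R, 1%R]) (k s)%:E)%E).
  apply: ge0_le_integral => //.
  - by move=> s _; rewrite lee_fin invr_ge0 addr_ge0 ?expR_ge0.
  - exact: measurable_funTS.
  - move=> s /=; rewrite in_itv /= => /andP[s0 s1]; rewrite lee_fin.
    have ps : 1 <= expR (p * s) by rewrite -[leLHS]expR0 ler_expR mulr_ge0 // ltW.
    have inv : (1 + expR 1)^-1 <= (1 + expR s)^-1.
      by rewrite lef_pV2 ?posrE ?ltr_pwDl ?expR_ge0 // lerD2l ler_expR.
    by rewrite -[leLHS]mul1r ler_pM // invr_ge0 addr_ge0 // expR_ge0.
apply: ge0_subset_integral => //.
by move=> s _; rewrite lee_fin.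
Qed.

(** Translating [s] by ln x turns x / (x + exp s) into 1 / (1 + exp (s - ln x)), and the factor exp
    (p s) releases x^p. *)
Lemma integral_resolvent_powR (x : R) : 0 < x ->
  (\int[mu]_s (expR (p * s) * (x / (x + expR s)))%:E
   = (x `^ p)%:E * \int[mu]_s (k s)%:E)%E.
Proof.
move=> x0; pose c := ln x; have xE : x = expR c by rewrite lnK.
have mk := measurable_logistic_kernel.
pose F : R -> R := fun s => s - c.
have dF (s : R) : is_derive s (1 : R) F (1 : R).
  by rewrite -[X in is_derive _ _ _ X]subr0; apply: is_deriveB.
have F1 : derive1 F = cst 1 by apply/funext => s; rewrite derive1E derive_val.
(* The substitution acts on the integral of [k] on the right, which becomes the integral of its
   translate by [c]. *)
rewrite (@increasing_ge0_integration_by_substitutionT _ F k); first last.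
- exact: logistic_kernel_ge0.
- exact: continuous_logistic_kernel.
- exact: cvg_addrr.
- exact: cvg_addrr_Ny.
- by move=> s.
- rewrite F1; exact: is_cvg_cst.
- rewrite F1; exact: is_cvg_cst.
- rewrite F1 => s; exact: cst_continuous.
- by move=> s t st; rewrite /F ltrD2r.
rewrite -ge0_integralZl_EFin ?powR_ge0 //; last 2 first.
- by move=> s _; rewrite lee_fin mulr_ge0 ?F1 ?mulr1 ?logistic_kernel_ge0.
- apply/measurable_EFinP; rewrite F1; apply: measurable_funM => //.
  by apply: measurableT_comp => //; apply: measurable_funB.
apply: eq_integral => s _; rewrite -EFinM F1; congr EFin.
rewrite [LHS]/= /k /F mulr1 /powR gt_eqF // -/c xE /= mulrBr !expRB.
have := expR_gt0 c; have := expR_gt0 s; have := expR_gt0 (p * c).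
move: (expR c) (expR s) (expR (p * c)) (expR (p * s)) => a b d e d0 b0 a0.
by field; rewrite ?gt_eqF ?addr_gt0.
Qed.

End PowerIntegral.

(** * Comparison of power sums through resolvents *)

Section ResolventOrder.
Local Open Scope classical_set_scope.

(** Taking the hypothesis at t = exp s, weighting it by exp (p s) and integrating over [s] gives the
    two power sums times one common constant. There are two index types because eigenvalues of one
    matrix will be compared with pairs of eigenvalues of two others. *)
Lemma sum_powR_le_of_resolvent {R : realType} (I J : finType) (a : I -> R)
    (x : I -> R) (b : J -> R) (y : J -> R) (p : R) :
  (forall i, 0 <= a i) -> (forall i, 0 < x i) ->
  (forall j, 0 <= b j) -> (forall j, 0 < y j) -> 0 < p -> p < 1 ->
  (forall t, 0 < t -> \sum_i a i * (x i / (x i + t)) <= \sum_j b j * (y j / (y j + t))) ->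
  \sum_i a i * x i `^ p <= \sum_j b j * y j `^ p.
Proof.
move=> a0 x0 b0 y0 p0 p1 le_res.
have mE (c u : R) : 0 <= c -> 0 < u ->
    measurable_fun setT (fun s => (c * (expR (p * s) * (u / (u + expR s))))%:E).
  move=> c0 u0; apply/measurable_EFinP; apply: measurable_funM => //.
  apply: continuous_measurable_fun => s.
  apply: (@continuousM _ _ (fun s => expR (p * s)) (fun s => u / (u + expR s))).
    apply: continuous_comp; last exact: continuous_expR.
    by apply: continuousM => //; exact: cst_continuous.
  apply: (@continuousM _ _ (fun=> u) (fun s => (u + expR s)^-1)).
    exact: cst_continuous.
  apply: continuousV; first by rewrite gt_eqF // addr_gt0 // expR_gt0.
  by apply: continuousD; [exact: cst_continuous | exact: continuous_expR].
have mS (K : finType) (c u : K -> R) : (forall k, 0 <= c k) -> (forall k, 0 < u k) ->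
    measurable_fun setT (fun s => (expR (p * s) * \sum_k c k * (u k / (u k + expR s)))%:E).
  move=> c0 u0; apply/measurable_EFinP; under eq_fun do rewrite mulr_sumr.
  apply: measurable_sum => k; apply/measurable_EFinP.
  by under eq_fun do rewrite mulrCA; exact: mE.
have nnE (c u s : R) : 0 <= c -> 0 < u ->
    0 <= c * (expR (p * s) * (u / (u + expR s))).
  by move=> c0 u0; rewrite !mulr_ge0 ?invr_ge0 ?addr_ge0 ?expR_ge0 //; exact: ltW.
have sumE (K : finType) (c u : K -> R) : (forall k, 0 <= c k) -> (forall k, 0 < u k) ->
    ((\sum_k c k * u k `^ p)%:E * \int[lebesgue_measure]_s (logistic_kernel p s)%:E
     = \int[lebesgue_measure]_s
         (expR (p * s) * \sum_k c k * (u k / (u k + expR s)))%:E)%E.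
  move=> c0 u0.
  transitivity (\int[lebesgue_measure]_s
      (\sum_k (c k * (expR (p * s) * (u k / (u k + expR s))))%:E))%E; last first.
    apply: eq_integral => s _; rewrite sumEFin; congr EFin.
    by rewrite mulr_sumr; apply: eq_bigr => k _; rewrite mulrCA.
  rewrite ge0_integral_sum //; last 2 first.
  - by move=> k; apply: mE.
  - by move=> k s _; rewrite lee_fin nnE.
  rewrite -sumEFin ge0_sume_distrl; last first.
    by move=> k _; rewrite lee_fin mulr_ge0 // powR_ge0.
  apply: eq_bigr => k _; rewrite EFinM -muleA -integral_resolvent_powR //.
  have mE1 := mE 1 (u k) ler01 (u0 k).
  rewrite -ge0_integralZl_EFin //; first by move=> s _; rewrite lee_fin -[leRHS]mul1r nnE.
  by under eq_fun do rewrite -[_ * _]mul1r.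
set K := (\int[lebesgue_measure]_s (logistic_kernel p s)%:E)%E in sumE.
have K0 : (0 < K)%E by exact: integral_logistic_kernel_gt0.
have Kfin : K \is a fin_num by rewrite ge0_fin_numE ?ltW // integral_logistic_kernel_lty.
(* [K] is positive and finite, so it cancels. *)
suff : ((\sum_i a i * x i `^ p)%:E * K <= (\sum_j b j * y j `^ p)%:E * K)%E.
  by rewrite lee_pmul2r // lee_fin.
rewrite !sumE //; apply: ge0_le_integral.
- by [].
- move=> s _; rewrite lee_fin mulr_ge0 ?expR_ge0 // sumr_ge0 // => k _.
  by rewrite !mulr_ge0 ?invr_ge0 ?addr_ge0 ?expR_ge0 //; exact: ltW.
- exact: mS.
- exact: mS.
- by move=> s _; rewrite lee_fin ler_wpM2l ?expR_ge0 // le_res // expR_gt0.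
Qed.

End ResolventOrder.

(** * Chord inequalities for powers *)

Section Convexity.
Local Open Scope classical_set_scope.
Context {R : realType}.

(** The last hypothesis is f'' >= 0 between [m] and [M]. The coefficient [e] lets one statement
    serve both x^p / p and its negative. *)
Lemma powR_quadratic_convex (m M e c p : R) (t : {i01 R})
    (f := fun x => e * x `^ p + c * x ^+ 2) : 0 < m -> m < M ->
  (forall x, m < x < M -> 0 <= e * (p * ((p - 1) * x `^ (p - 2))) + c * 2) ->
  f (t%:num * m + (1 - t%:num) * M) <= t%:num * f m + (1 - t%:num) * f M.
Proof.
move=> m0 mM dd.
have dpow (r z : R) : 0 < z -> is_derive z (1 : R) (@powR R ^~ r) (r * z `^ (r - 1)).
  by move=> z0; exact: is_derive1_powR.
have df (z : R) : 0 < z -> is_derive z (1 : R) f (e * (p * z `^ (p - 1)) + c * (2 * z)).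
  move=> z0; rewrite /f; have := dpow p z z0 => ?.
  apply: is_derive_eq.
  rewrite /GRing.scale /=; ring.
have ddf (z : R) : 0 < z ->
    is_derive z (1 : R) ('D_1 f) (e * (p * ((p - 1) * z `^ (p - 2))) + c * 2).
  move=> z0; have := dpow (p - 1) z z0; rewrite -addrA -opprD => ?.
  (* The formula for f' is known only at positive points, hence only near [z]. *)
  apply: (@near_eq_is_derive _ _ _ (fun z => e * (p * z `^ (p - 1)) + c * (2 * z))).
    near=> y; have y0 : 0 < y by near: y; exact: lt_nbhsr.
    by have [_ ->] := df y y0.
  apply: is_derive_eq.
  rewrite /GRing.scale /=; ring.
have pos (x : R) : m <= x -> 0 < x by exact: lt_le_trans.
have cf (x : R) : 0 < x -> {for x, continuous f}.
  by move=> x0; apply/differentiable_continuous/derivable1_diffP; have [] := df x x0.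
apply: (@second_derivative_convex _ f m M _ _ _ _ _ t (ltW mM)).
- move=> x /[dup] xmM /andP[mx _].
  by have [_ ->] := ddf x (pos x (ltW mx)); exact: dd.
- by apply: cvg_at_left_filter; apply: cf; rewrite pos // ltW.
- by apply: cvg_at_right_filter; apply: cf.
- by move=> x; rewrite in_itv /= => /andP[/ltW/pos x0 _]; have [] := df x x0.
- by move=> x; rewrite in_itv /= => /andP[/ltW/pos x0 _]; have [] := ddf x x0.
Unshelve. all: by end_near. Qed.

Lemma ge_powR_npos (r x y : R) : r <= 0 -> 0 < x -> x <= y -> y `^ r <= x `^ r.
Proof.
move=> r0 x0 xy; have y0 : 0 < y by exact: lt_le_trans xy.
rewrite -[r]opprK !(powRN _ (- r)) lef_pV2 ?posrE ?powR_gt0 //.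
by rewrite ge0_ler_powR ?nnegrE ?oppr_ge0 // ltW.
Qed.

(** This is convexity at t = (M - x) / (M - m), with the denominator cleared. *)
Lemma powR_quadratic_chord (m M e c p x : R)
    (f := fun x => e * x `^ p + c * x ^+ 2) : 0 < m -> m < M ->
  (forall z, m < z < M -> 0 <= e * (p * ((p - 1) * z `^ (p - 2))) + c * 2) ->
  m <= x -> x <= M ->
  (M - m) * f x <= (M - x) * f m + (x - m) * f M.
Proof.
move=> m0 mM dd mx xM; have Mm : 0 < M - m by rewrite subr_gt0.
have t0 : 0 <= (M - x) / (M - m) by rewrite divr_ge0 ?subr_ge0 // ltW.
have t1 : (M - x) / (M - m) <= 1 by rewrite ler_pdivrMr // mul1r lerD2l lerN2.
have := powR_quadratic_convex (Itv01 t0 t1) m0 mM dd.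
rewrite -/f /= => /(ler_wpM2l (ltW Mm)).
rewrite (_ : _ * m + _ * M = x); last by field; rewrite gt_eqF.
move=> /le_trans; apply; rewrite /f le_eqVlt; apply/orP; left; apply/eqP.
by field; rewrite gt_eqF.
Qed.

(** The chord is affine, so its average depends only on the total mass and the mean; both are 1, and
    the average is the value of the chord at 1. There x^p contributes [L], and x^2 contributes (M -
    1) m^2 + (1 - m) M^2 = (M - m) (M + m - M m). *)
Lemma sum_powR_quadratic_chord (J : finType) (b y : J -> R) (m M e c p : R)
    (L := (M - 1) * m `^ p + (1 - m) * M `^ p) : 0 < m -> m < M ->
  (forall z, m < z < M -> 0 <= e * (p * ((p - 1) * z `^ (p - 2))) + c * 2) ->
  (forall j, 0 <= b j) -> (forall j, m <= y j <= M) ->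
  \sum_j b j = 1 -> \sum_j b j * y j = 1 ->
  (M - m) * (e * (\sum_j b j * y j `^ p) + c * \sum_j b j * y j ^+ 2)
    <= e * L + c * ((M - m) * (M + m - M * m)).
Proof.
move=> m0 mM dd b0 yI b1 by1.
have chord j := powR_quadratic_chord m0 mM dd (proj1 (andP (yI j))) (proj2 (andP (yI j))).
pose f x := e * x `^ p + c * x ^+ 2.
have -> : (M - m) * (e * (\sum_j b j * y j `^ p) + c * \sum_j b j * y j ^+ 2)
    = \sum_j b j * ((M - m) * f (y j)).
  rewrite !mulr_sumr -big_split mulr_sumr; apply: eq_bigr => j _ /=.
  by rewrite /f; ring.
apply: (@le_trans _ _ (\sum_j b j * ((M - y j) * f m + (y j - m) * f M))).
  by apply: ler_sum => j _; apply: ler_wpM2l => //; exact: chord.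
rewrite (_ : \sum_j _ = (M * f m - m * f M) * (\sum_j b j)
                        + (f M - f m) * \sum_j b j * y j); last first.
  rewrite !mulr_sumr -big_split; apply: eq_bigr => j _ /=; ring.
by rewrite b1 by1 le_eqVlt; apply/orP; left; apply/eqP; rewrite /f /L; ring.
Qed.

Lemma tsallis_bounds_sum (J : finType) (b y : J -> R) (m M p : R)
    (S := \sum_j b j * y j ^+ 2) : 0 < m -> m < M -> p <= 1 -> p != 0 ->
  (forall j, 0 <= b j) -> (forall j, m <= y j <= M) ->
  \sum_j b j = 1 -> \sum_j b j * y j = 1 ->
  (1 - p) / 2 * (M `^ (p - 2) - m `^ (p - 2)) * (M + m - M * m)
    + (1 - p) / 2 * (m `^ (p - 2) - M `^ (p - 2) * S)
  <= p^-1 * (\sum_j b j * y j `^ p - 1)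
  <= (1 - p) / 2 * (m `^ (p - 2) - M `^ (p - 2)) * (M + m - M * m)
    + (1 - p) / 2 * (M `^ (p - 2) - m `^ (p - 2) * S).
Proof.
move=> m0 mM p1 p0 b0 yI b1 by1.
have M0 : 0 < M by exact: lt_trans mM.
have Mm : 0 < M - m by rewrite subr_gt0.
(* The mean of points of [m, M] stays in [m, M]; hence the chord inequality is available at x =
   1. *)
have bm1 : m <= 1.
  rewrite -by1 -[m]mulr1 -b1 mulr_sumr ler_sum // => j _.
  by rewrite mulrC ler_wpM2l //; case/andP: (yI j).
have bM1 : 1 <= M.
  rewrite -by1 -[M]mulr1 -b1 mulr_sumr ler_sum // => j _.
  by rewrite [leRHS]mulrC ler_wpM2l //; case/andP: (yI j).
have anti z : m < z < M -> M `^ (p - 2) <= z `^ (p - 2) <= m `^ (p - 2).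
  by case/andP=> mz zM; rewrite !ge_powR_npos //; try lra; try exact: ltW.
have p1' : 0 <= 1 - p by rewrite subr_ge0.
(* The factor of x^2 compensates the most negative second derivative of x^p / p, approached at [m].
   The division by [p] makes the argument independent of its sign. *)
have cvx z : m < z < M ->
    0 <= p^-1 * (p * ((p - 1) * z `^ (p - 2))) + (1 - p) / 2 * m `^ (p - 2) * 2.
  move=> /anti /andP[_ zm]; rewrite mulKf //.
  have -> : (p - 1) * z `^ (p - 2) + (1 - p) / 2 * m `^ (p - 2) * 2
      = (1 - p) * (m `^ (p - 2) - z `^ (p - 2)) by field.
  by rewrite mulr_ge0 // subr_ge0.
(* With M^(p - 2) in place of m^(p - 2) the sum is concave, so its negative is the convex function
   used. *)
have ccv z : m < z < M ->
    0 <= - p^-1 * (p * ((p - 1) * z `^ (p - 2))) + (- ((1 - p) / 2) * M `^ (p - 2)) * 2.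
  move=> /anti /andP[Mz _]; rewrite !mulNr mulKf //.
  have -> : - ((p - 1) * z `^ (p - 2)) - (1 - p) / 2 * M `^ (p - 2) * 2
      = (1 - p) * (z `^ (p - 2) - M `^ (p - 2)) by field.
  by rewrite mulr_ge0 // subr_ge0.
have H1 := sum_powR_quadratic_chord m0 mM cvx b0 yI b1 by1.
have H3 := sum_powR_quadratic_chord m0 mM ccv b0 yI b1 by1.
have H2 := powR_quadratic_chord m0 mM cvx bm1 bM1.
have H4 := powR_quadratic_chord m0 mM ccv bm1 bM1.
rewrite powR1 expr1n !mulr1 in H2 H4.
rewrite -/S in H1 H3.
set T := \sum_j b j * y j `^ p in H1 H3 *.
move: H1 H2 H3 H4.
set mp := m `^ p; set Mp := M `^ p; set c := M `^ (p - 2); set d := m `^ (p - 2).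
set h := (1 - p) / 2; set E := p^-1 => H1 H2 H3 H4.
clearbody T S mp Mp c d h E.
(* The lower bound is [H2] + [H3] and the upper bound [H1] + [H4]; the terms in m^p and M^p cancel
   in each sum. *)
by apply/andP; split; rewrite -(ler_pM2l Mm); lra.
Qed.

End Convexity.

(** * Positive matrices and their spectral decomposition *)

Section PositiveMatrix.
Local Open Scope sesquilinear_scope.
Local Close Scope complex_scope.
Context {C : numClosedFieldType}.

Lemma adjmxE m n (A : 'M[C]_(m, n)) i j : (A^t*) i j = (A j i)^*.
Proof. by rewrite !mxE. Qed.

Lemma adjmxM m n q (A : 'M[C]_(m, n)) (B : 'M[C]_(n, q)) :
  (A *m B)^t* = B^t* *m A^t*.
Proof. by rewrite trmx_mul map_mxM. Qed.

Lemma adjmxB m n (A B : 'M[C]_(m, n)) : (A - B)^t* = A^t* - B^t*.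
Proof. by rewrite linearB /= map_mxB. Qed.

Context {n : nat}.
Implicit Types (A B X Y H V W s : 'M[C]_n) (d e : 'rV[C]_n) (c t : C).

Lemma mxtraceB A B : \tr (A - B) = \tr A - \tr B.
Proof. exact: raddfB. Qed.

(** This is [positive_op] over an arbitrary [numClosedFieldType]; over [R[i]] the two are
    convertible. *)
Definition psdmx A : Prop := forall v : 'cV[C]_n, 0 <= (v^t* *m A *m v) 0 0.

(** The entry is the quadratic form of [A] at the adjoint of row [i] of [E]. *)
Lemma psdmx_form m A (E : 'M[C]_(m, n)) i : psdmx A -> 0 <= (E *m A *m E^t*) i i.
Proof.
move=> A0; have := A0 ((row i E)^t*); rewrite trmxCK -row_mul !mxE.
by under eq_bigr do rewrite !mxE; under [X in _ -> 0 <= X]eq_bigr do rewrite !mxE.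
Qed.

Lemma psdmx_trace A (E : 'M[C]_n) : psdmx A -> 0 <= \tr (E *m A *m E^t*).
Proof. by move=> A0; apply: sumr_ge0 => i _; exact: psdmx_form. Qed.

Lemma psdmx_congr A (E : 'M[C]_n) : psdmx A -> psdmx (E^t* *m A *m E).
Proof. by move=> A0 v; have := A0 (E *m v); rewrite adjmxM !mulmxA. Qed.

Lemma psdmx1 : psdmx 1%:M.
Proof.
move=> v; rewrite mulmx1 mxE sumr_ge0 // => i _.
by rewrite adjmxE mulrC mul_conjC_ge0.
Qed.

(* A - A^* is normal with zero spectrum. *)
Lemma psdmx_adj A : psdmx A -> A^t* = A.
Proof.
move=> A0; pose B := A - A^t*.
have Badj : B^t* = - B by rewrite /B adjmxB trmxCK opprB.
have Bnormal : B \is normalmx by apply/normalmxP; rewrite Badj mulmxN mulNmx.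
pose V := spectralmx B; have Vu : V \is unitarymx := spectral_unitarymx B.
have Bform i : (V *m B *m V^t*) i i = 0.
  (* A nonnegative diagonal entry is real, so [A] and its adjoint have the same diagonal in the
     basis [V]. *)
  have Ai := psdmx_form V i A0.
  rewrite mulmxBr mulmxBl [LHS]mxE [X in _ + X]mxE.
  have -> : V *m A^t* *m V^t* = (V *m A *m V^t*)^t* by rewrite !adjmxM trmxCK mulmxA.
  by rewrite adjmxE (CrealP (ger0_real Ai)) subrr.
have BE := orthomx_spectralP Bnormal; rewrite -/V in BE.
have : diag_mx (spectral_diag B) = 0.
  apply/matrixP => i j; rewrite [RHS]mxE.
  have [<-|ij] := eqVneq i j; last by rewrite mxE (negPf ij) mulr0n.
  rewrite -[RHS](Bform i) {2}BE invmx_unitary // !mulmxA.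
  by rewrite (unitarymxP Vu) mul1mx -mulmxA (unitarymxP Vu) mulmx1.
move=> D0; move: BE; rewrite D0 mulmx0 mul0mx => /eqP.
by rewrite subr_eq0 => /eqP <-.
Qed.

(** * Matrices diagonal in a unitary basis *)

Definition udiag V (d : 'rV[C]_n) : 'M[C]_n := V^t* *m diag_mx d *m V.

Lemma udiagM V d e : V \is unitarymx ->
  udiag V d *m udiag V e = udiag V (\row_k (d 0 k * e 0 k)).
Proof.
move=> Vu; rewrite /udiag !mulmxA mulmxtVK //.
by rewrite -[_ *m diag_mx _ *m diag_mx _]mulmxA mulmx_diag.
Qed.

Lemma udiag_adj V d : (forall k, d 0 k \is Num.real) -> (udiag V d)^t* = udiag V d.
Proof.
move=> dreal; rewrite /udiag !adjmxM trmxCK mulmxA tr_diag_mx map_diag_mx.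
by rewrite (_ : map_mx _ d = d) //; apply/rowP => k; rewrite !mxE; exact: CrealP.
Qed.

Lemma udiag_scalar V c : V \is unitarymx -> udiag V (const_mx c) = c%:M.
Proof.
move=> Vu; rewrite /udiag diag_const_mx mul_mx_scalar -scalemxAl.
have /mulmx1C -> : V *m V^t* = 1%:M by exact/unitarymxP.
by rewrite scalemx1.
Qed.

Lemma udiagD V d e : udiag V (d + e) = udiag V d + udiag V e.
Proof. by rewrite /udiag raddfD /= mulmxDr mulmxDl. Qed.

Lemma udiag_conj V d : V \is unitarymx -> V *m udiag V d *m V^t* = diag_mx d.
Proof.
move=> Vu; rewrite /udiag !mulmxA (unitarymxP Vu) mul1mx -mulmxA.
by rewrite (unitarymxP Vu) mulmx1.
Qed.

Lemma trace_mul_udiag A V d :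
  \tr (A *m udiag V d) = \sum_k (V *m A *m V^t*) k k * d 0 k.
Proof.
rewrite /udiag !mulmxA mxtrace_mulC !mulmxA; apply: eq_bigr => k _.
by rewrite mul_mx_diag !mxE.
Qed.

(** Expanding in both eigenbases turns the trace of a product of two noncommuting matrices into a
    double sum with nonnegative weights. *)
Lemma trace_udiag2 V W d e (N := W *m V^t*) :
  \tr (udiag V d *m udiag W e) = \sum_i \sum_j d 0 i * e 0 j * `|N j i| ^+ 2.
Proof.
rewrite trace_mul_udiag exchange_big; apply: eq_bigr => j _.
have -> : W *m udiag V d *m W^t* = N *m diag_mx d *m N^t*.
  by rewrite /N /udiag adjmxM trmxCK !mulmxA.
rewrite mxE mulr_suml; apply: eq_bigr => i _.
by rewrite mul_mx_diag mxE adjmxE normCK; ring.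
Qed.

Lemma psdmx_spectral A : psdmx A -> udiag (spectralmx A) (spectral_diag A) = A.
Proof.
move=> A0; have Aherm : A \is hermsymmx.
  by apply/is_hermitianmxP; rewrite expr0 scale1r psdmx_adj.
rewrite [RHS](orthomx_spectralP (hermitian_normalmx Aherm)).
by rewrite invmx_unitary ?spectral_unitarymx.
Qed.

Lemma spectral_diag_form A k : psdmx A ->
  spectral_diag A 0 k = (spectralmx A *m A *m (spectralmx A)^t*) k k.
Proof.
move=> A0; rewrite -{3}(psdmx_spectral A0) udiag_conj ?spectral_unitarymx //.
by rewrite mxE eqxx mulr1n.
Qed.

Lemma spectral_diag_ge c A k : psdmx A -> psdmx (A - c%:M) -> c <= spectral_diag A 0 k.
Proof.
move=> A0 /(psdmx_form (spectralmx A) k).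
rewrite mulmxBr mulmxBl mxE -spectral_diag_form // mxE mul_mx_scalar -scalemxAl.
by rewrite (unitarymxP (spectral_unitarymx A)) !mxE eqxx mulr1 subr_ge0.
Qed.

Lemma spectral_diag_le c A k : psdmx A -> psdmx (c%:M - A) -> spectral_diag A 0 k <= c.
Proof.
move=> A0 /(psdmx_form (spectralmx A) k).
rewrite mulmxBr mulmxBl mxE [X in _ + X]mxE -spectral_diag_form //.
rewrite mul_mx_scalar -scalemxAl (unitarymxP (spectral_unitarymx A)).
by rewrite !mxE eqxx mulr1 subr_ge0.
Qed.

Lemma spectral_diag_gt0 A k : psdmx A -> A \in unitmx -> 0 < spectral_diag A 0 k.
Proof.
move=> A0 Aunit; rewrite lt_neqAle spectral_diag_form // psdmx_form // andbT.
rewrite -spectral_diag_form //; apply/negP => /eqP k0; move: Aunit.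
rewrite -(psdmx_spectral A0) /udiag !unitmx_mul => /andP[/andP[_]].
rewrite unitmxE det_diag unitfE => /negP[]; apply/eqP.
by rewrite (bigD1 k) //= -k0 mul0r.
Qed.

(* Expand Tr (E X E^* ) + t Tr (F F^* ) >= 0 with E = Y^* H - H s and
   F = Y H - H s; the equation for [Y] removes the terms quadratic in [Y]. *)
Lemma trace_resolvent_le H X s Y t :
  H^t* = H -> s^t* = s -> psdmx X -> 0 <= t ->
  s *m (X + t%:M) = 1%:M ->
  H *m X *m H *m Y + t *: (Y *m (H *m H)) = H *m H ->
  \tr (H *m H *m Y) <= \tr (H *m H *m s).
Proof.
move=> Hh sh X0 t0 sX HY.
(* As [s] inverts X + t, both s X and X s can be replaced by 1 - t s. *)
have sXE : s *m X = 1%:M - t *: s by rewrite -sX mulmxDr mul_mx_scalar addrK.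
have XsE : X *m s = 1%:M - t *: s.
  by have /mulmx1C <- := sX; rewrite mulmxDl mul_scalar_mx addrK.
have F0 : 0 <= \tr ((Y *m H - H *m s) *m (H *m Y^t* - s *m H)).
  have := psdmx_trace (Y *m H - H *m s) psdmx1.
  by rewrite mulmx1 adjmxB !adjmxM Hh sh.
have E0 : 0 <= \tr ((Y^t* *m H - H *m s) *m X *m (H *m Y - s *m H)).
  have := psdmx_trace (Y^t* *m H - H *m s) X0.
  by rewrite adjmxB !adjmxM trmxCK Hh sh.
have EE : \tr ((Y^t* *m H - H *m s) *m X *m (H *m Y - s *m H)) =
    \tr (Y^t* *m (H *m X *m H *m Y)) - \tr (Y^t* *m (H *m H)) - \tr (H *m H *m Y)
    + \tr (H *m s *m H)
    + t * (\tr (Y^t* *m (H *m s *m H)) + \tr (H *m s *m H *m Y) - \tr (H *m s *m s *m H)).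
  have -> : (Y^t* *m H - H *m s) *m X *m (H *m Y - s *m H)
      = Y^t* *m (H *m X *m H *m Y) - Y^t* *m (H *m (X *m s) *m H)
        - (H *m (s *m X) *m H *m Y - H *m (s *m X) *m s *m H).
    by rewrite !mulmxBl !mulmxBr !mulmxA.
  rewrite XsE sXE !(mulmxBr, mulmxBl) !mulmx1 -?(scalemxAl, scalemxAr).
  by rewrite !mulmxA !mxtraceB !mxtraceZ; ring.
have FE : \tr ((Y *m H - H *m s) *m (H *m Y^t* - s *m H)) =
    \tr (Y^t* *m (Y *m (H *m H))) - \tr (H *m s *m H *m Y)
    - \tr (Y^t* *m (H *m s *m H)) + \tr (H *m s *m s *m H).
  rewrite mulmxBl !mulmxBr !mxtraceB.
  rewrite [\tr (Y^t* *m (Y *m _))]mxtrace_mulC [\tr (Y^t* *m (H *m s *m H))]mxtrace_mulC.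
  by rewrite [\tr (H *m s *m H *m Y)]mxtrace_mulC !mulmxA; ring.
have HYE : \tr (Y^t* *m (H *m X *m H *m Y)) + t * \tr (Y^t* *m (Y *m (H *m H)))
    = \tr (Y^t* *m (H *m H)).
  by rewrite -{2}HY mulmxDr -scalemxAr mxtraceD mxtraceZ.
have trs : \tr (H *m s *m H) = \tr (H *m H *m s) by rewrite mxtrace_mulC mulmxA.
(* In the first trace plus [t] times the second, the terms mixing [Y] and [s] and those with two
   factors [s] cancel. With [HYE], only Tr (H H s) - Tr (H H Y) remains. *)
rewrite -subr_ge0 -trs.
have := addr_ge0 E0 (mulr_ge0 t0 F0); rewrite EE FE -HYE.
by congr (0 <= _); ring.
Qed.

(** The left side is Tr (A Y) for the solution [Y] of B Y + t Y A = A, written in the eigenbases of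
    [A] and [B]; [trace_resolvent_le] then applies. *)
Lemma trace_joint_spectrum_resolvent_le A B H X s t
    (a := spectral_diag A) (b := spectral_diag B)
    (N := spectralmx B *m (spectralmx A)^t*) :
  psdmx A -> A \in unitmx -> psdmx B -> B \in unitmx -> 0 < t ->
  H^t* = H -> s^t* = s -> psdmx X ->
  s *m (X + t%:M) = 1%:M -> A = H *m H -> B = H *m X *m H ->
  \sum_i \sum_j a 0 i * (a 0 i / (b 0 j + t * a 0 i)) * `|N j i| ^+ 2 <= \tr (A *m s).
Proof.
move=> A0 Aun B0 Bun t0 Hh sh X0 sX AE BE.
have a0 i : 0 < a 0 i by exact: spectral_diag_gt0.
have b0 j : 0 < b 0 j by exact: spectral_diag_gt0.
have Ad := psdmx_spectral A0; have Bd := psdmx_spectral B0.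
rewrite -/a in Ad; rewrite -/b in Bd.
have Uu := spectral_unitarymx A; have Wu := spectral_unitarymx B.
move: @N Uu Wu Ad Bd; set U := spectralmx A; set W := spectralmx B => N Uu Wu Ad Bd.
(* In the two eigenbases the equation for [Y] reads (b_j + t a_i) G_ji = N_ji a_i, which is solved
   entry by entry. *)
pose G := \matrix_(j, i) (a 0 i / (b 0 j + t * a 0 i) * N j i) : 'M[C]_n.
pose Y := W^t* *m G *m U.
have WtW : W^t* *m W = 1%:M by apply: mulmx1C; exact/unitarymxP.
have -> : \sum_i \sum_j a 0 i * (a 0 i / (b 0 j + t * a 0 i)) * `|N j i| ^+ 2
    = \tr (A *m Y).
  rewrite -Ad /Y /udiag.
  have -> : U^t* *m diag_mx a *m U *m (W^t* *m G *m U)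
     = U^t* *m (diag_mx a *m (N^t* *m G) *m U).
    by rewrite /N adjmxM trmxCK !mulmxA.
  rewrite mxtrace_mulC mulmxtVK //.
  apply: eq_bigr => i _; rewrite mul_diag_mx mxE mxE mulr_sumr.
  by apply: eq_bigr => j _; rewrite adjmxE [G j i]mxE normCK; ring.
rewrite AE; apply: (@trace_resolvent_le H X s Y t) => //; first exact: ltW.
rewrite -BE -AE -{1}Bd -{1}Ad /Y /udiag.
have -> : W^t* *m diag_mx b *m W *m (W^t* *m G *m U) = W^t* *m (diag_mx b *m G) *m U.
  by rewrite !mulmxA mulmxtVK.
have -> : W^t* *m G *m U *m (U^t* *m diag_mx a *m U) = W^t* *m (G *m diag_mx a) *m U.
  by rewrite !mulmxA mulmxtVK.
rewrite scalemxAl scalemxAr -mulmxDl -mulmxDr -Ad.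
have -> : udiag U a = W^t* *m (N *m diag_mx a) *m U.
  by rewrite /N /udiag !mulmxA WtW mul1mx.
congr (_ *m _ *m _); apply/matrixP => j i.
rewrite mul_diag_mx !mul_mx_diag !mxE.
have d0 : b 0 j + t * a 0 i != 0 by rewrite gt_eqF // addr_gt0 // mulr_gt0.
by field.
Qed.

(** * Congruence by the inverse [K] of a Hermitian square root [H] of [A] *)

Section Ratio.
Variables A B H K : 'M[C]_n.
Hypotheses (Hh : H^t* = H) (Kh : K^t* = K) (HK : H *m K = 1%:M) (AE : A = H *m H).
Let X := K *m B *m K.

Let KH : K *m H = 1%:M. Proof. exact: mulmx1C. Qed.

Lemma ratioK : H *m X *m H = B.
Proof. by rewrite /X !mulmxA HK mul1mx -mulmxA KH mulmx1. Qed.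

Lemma psdmx_ratio : psdmx B -> psdmx X.
Proof. by move=> /(psdmx_congr K); rewrite Kh. Qed.

(** The congruence sends multiples of [A] to scalars, so Loewner bounds by multiples of [A] become
    spectral bounds on [X]. *)
Let ratio_scale c : K *m (c *: A) *m K = c%:M.
Proof.
by rewrite AE -scalemxAr -scalemxAl !mulmxA KH mul1mx HK scalemx1.
Qed.

Lemma psdmx_ratio_ge c : psdmx (B - c *: A) -> psdmx (X - c%:M).
Proof. by move=> /(psdmx_congr K); rewrite Kh mulmxBr mulmxBl ratio_scale. Qed.

Lemma psdmx_ratio_le c : psdmx (c *: A - B) -> psdmx (c%:M - X).
Proof. by move=> /(psdmx_congr K); rewrite Kh mulmxBr mulmxBl ratio_scale. Qed.

(** By cyclicity Tr (H H X) = Tr (H X H). This gives the spectral distribution of [X] mean 1 when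
    [B] has unit trace. *)
Lemma trace_ratio : \tr (A *m X) = \tr B.
Proof. by rewrite -[in RHS]ratioK AE -mulmxA mxtrace_mulC -mulmxA. Qed.

End Ratio.

(* The rows of [spectralmx X] are the adjoints of the eigenvectors v_k of [X]:
   this is <v_k, A v_k>. *)
Definition spectral_weight A X k : C := (spectralmx X *m A *m (spectralmx X)^t*) k k.

Lemma spectral_weight_ge0 A X k : psdmx A -> 0 <= spectral_weight A X k.
Proof. exact: psdmx_form. Qed.

(** Total mass of the measure that puts each weight at the corresponding eigenvalue of [X]; its
    first and second moments follow. *)
Lemma sum_spectral_weight A X : \sum_k spectral_weight A X k = \tr A.
Proof.
rewrite -[in RHS](mulmx1 A) -(udiag_scalar 1 (spectral_unitarymx X)) trace_mul_udiag.
by apply: eq_bigr => k _; rewrite [const_mx _ _ _]mxE mulr1.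
Qed.

Lemma sum_spectral_weight_diag A X : psdmx X ->
  \sum_k spectral_weight A X k * spectral_diag X 0 k = \tr (A *m X).
Proof. by move=> X0; rewrite -trace_mul_udiag psdmx_spectral. Qed.

Lemma sum_spectral_weight_diag2 A X : psdmx X ->
  \sum_k spectral_weight A X k * spectral_diag X 0 k ^+ 2 = \tr (A *m (X *m X)).
Proof.
move=> X0; rewrite -[in RHS](psdmx_spectral X0) udiagM ?spectral_unitarymx //.
by rewrite trace_mul_udiag; apply: eq_bigr => k _; rewrite [(\row__ _) _ _]mxE.
Qed.

(* |<u_i, w_j>|^2 for the eigenvectors u_i of [A] and w_j of [B]. *)
Definition overlap A B i j : C := `|(spectralmx B *m (spectralmx A)^t*) j i| ^+ 2.

(** The identity is diagonal in the eigenbasis of [B], so this is the double expansion of Tr (A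
    1). *)
Lemma sum_overlap_l A B : psdmx A ->
  \sum_i \sum_j spectral_diag A 0 i * overlap A B i j = \tr A.
Proof.
move=> A0; rewrite -[in RHS](mulmx1 A) -[in RHS](psdmx_spectral A0).
rewrite -(udiag_scalar 1 (spectral_unitarymx B)) trace_udiag2.
by apply: eq_bigr => i _; apply: eq_bigr => j _; rewrite [const_mx _ _ _]mxE mulr1.
Qed.

Lemma sum_overlap_r A B : psdmx B ->
  \sum_i \sum_j spectral_diag B 0 j * overlap A B i j = \tr B.
Proof.
move=> B0; rewrite -[in RHS](mul1mx B) -[in RHS](psdmx_spectral B0).
rewrite -(udiag_scalar 1 (spectral_unitarymx A)) trace_udiag2.
by apply: eq_bigr => i _; apply: eq_bigr => j _; rewrite [const_mx _ _ _]mxE mul1r.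
Qed.

Lemma overlap_resolvent_le A B H K t (X := K *m B *m K)
    (a := spectral_diag A) (b := spectral_diag B) :
  psdmx A -> A \in unitmx -> psdmx B -> B \in unitmx -> 0 < t ->
  H^t* = H -> K^t* = K -> H *m K = 1%:M -> A = H *m H ->
  \sum_i \sum_j a 0 i * (a 0 i / (b 0 j + t * a 0 i)) * overlap A B i j
    <= \sum_k spectral_weight A X k * (spectral_diag X 0 k + t)^-1.
Proof.
move=> A0 Aun B0 Bun t0 Hh Kh HK AE.
have X0 : psdmx X by exact: psdmx_ratio.
have x0 k : 0 < spectral_diag X 0 k + t.
  by rewrite ltr_wpDl // spectral_diag_form // psdmx_form.
pose V := spectralmx X; have Vu : V \is unitarymx := spectral_unitarymx X.
(* The inverse of X + t, built in the eigenbasis of [X]. *)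
pose s := udiag V (\row_k (spectral_diag X 0 k + t)^-1).
have -> : \sum_k spectral_weight A X k * (spectral_diag X 0 k + t)^-1 = \tr (A *m s).
  by rewrite trace_mul_udiag; apply: eq_bigr => k _; rewrite [(\row__ _) _ _]mxE.
apply: (@trace_joint_spectrum_resolvent_le A B H X) => //.
- by apply: udiag_adj => k; rewrite mxE realV gtr0_real.
- rewrite -{1}(psdmx_spectral X0) -(udiag_scalar t Vu) -udiagD udiagM //.
  rewrite -(udiag_scalar 1 Vu); congr udiag; apply/rowP => k.
  by rewrite !mxE mulVf // gt_eqF.
- by rewrite ratioK.
Qed.

End PositiveMatrix.

(** * Traces of operator functions *)

Section Operators.
Local Open Scope sesquilinear_scope.
Context {R : realType} {n : nat}.
Notation C := R[i].
Implicit Types (A B X : 'M[C]_n).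

Lemma ReK_ge0 (z : C) : 0 <= z -> (complex.Re z)%:C = z.
Proof. by move=> z0; rewrite RRe_real // ger0_real. Qed.

(** Real powers need a real argument; taking the real part loses nothing when [A] is positive. *)
Definition eigval A (k : 'I_n) : R := complex.Re (spectral_diag A 0 k).

Lemma positive_op_psdmx A : positive_op A -> psdmx A.
Proof. by []. Qed.

Lemma eigvalE A k : psdmx A -> spectral_diag A 0 k = (eigval A k)%:C.
Proof. by move=> A0; rewrite /eigval ReK_ge0 // spectral_diag_form // psdmx_form. Qed.

Lemma eigval_gt0 A k : psdmx A -> A \in unitmx -> 0 < eigval A k.
Proof. by move=> A0 Au; have := spectral_diag_gt0 k A0 Au; rewrite eigvalE // ltcR. Qed.

Lemma op_funE f A :
  op_fun f A = udiag (spectralmx A) (\row_k (f (eigval A k))%:C).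
Proof.
rewrite /op_fun (invmx_unitary (spectral_unitarymx A)) /udiag.
have -> : map_mx (fun x => (f (complex.Re x))%:C) (spectral_diag A)
    = \row_k (f (eigval A k))%:C by apply/rowP => k; rewrite !mxE.
by [].
Qed.

Lemma op_fun_adj f A : (op_fun f A)^t* = op_fun f A.
Proof.
rewrite op_funE udiag_adj // => k; rewrite mxE; apply/complex_realP.
by eexists.
Qed.

Lemma op_funM f g A : op_fun f A *m op_fun g A = op_fun (fun x => f x * g x) A.
Proof.
rewrite 3!op_funE (udiagM _ _ (spectral_unitarymx A)); congr udiag.
by apply/rowP => k; rewrite mxE [X in X * _]mxE [X in _ * X]mxE [RHS]mxE rmorphM.
Qed.

Lemma op_pow_half A : psdmx A -> A \in unitmx ->
  op_pow A 2^-1 *m op_pow A 2^-1 = A.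
Proof.
move=> A0 Au; rewrite /op_pow op_funM op_funE -[RHS](psdmx_spectral A0).
congr udiag; apply/rowP => k; rewrite mxE eigvalE // -expr2.
have a0 := eigval_gt0 k A0 Au.
by rewrite -powR_mulrn ?powR_ge0 // -powRrM mulVf ?pnatr_eq0 // powRr1 // ltW.
Qed.

Lemma op_pow_halfN A : psdmx A -> A \in unitmx ->
  op_pow A 2^-1 *m op_pow A (- 2^-1) = 1%:M.
Proof.
move=> A0 Au; rewrite /op_pow op_funM op_funE.
rewrite -(udiag_scalar 1 (spectral_unitarymx A)); congr udiag.
apply/rowP => k; rewrite mxE [RHS]mxE powRN mulfV //.
by rewrite gt_eqF // powR_gt0 // eigval_gt0.
Qed.

Definition weight A X k : R := complex.Re (spectral_weight A X k).

Lemma weightE A X k : psdmx A -> spectral_weight A X k = (weight A X k)%:C.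
Proof. by move=> A0; rewrite /weight ReK_ge0 // spectral_weight_ge0. Qed.

Lemma weight_ge0 A X k : psdmx A -> 0 <= weight A X k.
Proof. by move=> A0; have := spectral_weight_ge0 X k A0; rewrite weightE // ler0c. Qed.

Definition overlapr A B i j : R := complex.Re (overlap A B i j).

Lemma overlap_ge0 A B i j : 0 <= overlap A B i j.
Proof. by rewrite exprn_ge0. Qed.

Lemma overlaprE A B i j : overlap A B i j = (overlapr A B i j)%:C.
Proof. by rewrite /overlapr ReK_ge0 // overlap_ge0. Qed.

Lemma overlapr_ge0 A B i j : 0 <= overlapr A B i j.
Proof. by have := overlap_ge0 A B i j; rewrite overlaprE ler0c. Qed.

(** Cyclicity joins the two outer square roots into [A], leaving Tr (A X^p). *)
Lemma trace_op_natural A B p : psdmx A -> A \in unitmx ->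
  let X := op_ratio A B in
  \tr (op_natural p A B) = (\sum_k weight A X k * eigval X k `^ p)%:C.
Proof.
move=> A0 Au X; rewrite /op_natural -/X mxtrace_mulC mulmxA op_pow_half //.
rewrite /op_pow op_funE trace_mul_udiag rmorph_sum; apply: eq_bigr => k _.
by rewrite -/(spectral_weight A X k) weightE // mxE rmorphM.
Qed.

Lemma trace_op_pow2 A B p q :
  \tr (op_pow A p *m op_pow B q)
  = (\sum_i \sum_j eigval A i `^ p * eigval B j `^ q * overlapr A B i j)%:C.
Proof.
rewrite /op_pow !op_funE trace_udiag2 rmorph_sum; apply: eq_bigr => i _.
rewrite rmorph_sum; apply: eq_bigr => j _.
rewrite -/(overlap A B i j) overlaprE [X in X * _ * _]mxE [X in _ * X * _]mxE.
by rewrite !rmorphM.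
Qed.

(** * Spectral sums for two positive invertible matrices *)

Section Pair.
Variables A B : 'M[C]_n.
Hypotheses (A0 : psdmx A) (Au : A \in unitmx) (B0 : psdmx B) (Bu : B \in unitmx).
Let X := op_ratio A B.
Let H := op_pow A 2^-1.
Let K := op_pow A (- 2^-1).
Let Hh : H^t* = H := op_fun_adj _ A.
Let Kh : K^t* = K := op_fun_adj _ A.
Let HK : H *m K = 1%:M := op_pow_halfN A0 Au.
Let AE : A = H *m H := esym (op_pow_half A0 Au).

Lemma psdmx_op_ratio : psdmx X.
Proof. exact: psdmx_ratio Kh B0. Qed.
Let X0 := psdmx_op_ratio.

Lemma eigval_op_ratio_itv (m M : R) k :
  loewner_le (m%:C *: A) B -> loewner_le B (M%:C *: A) -> m <= eigval X k <= M.
Proof.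
move=> /(psdmx_ratio_ge Kh HK AE) mX /(psdmx_ratio_le Kh HK AE) XM.
have := spectral_diag_ge k X0 mX; have := spectral_diag_le k X0 XM.
by rewrite eigvalE // !lecR => -> ->.
Qed.

Lemma sum_weight : (\sum_k weight A X k)%:C = \tr A.
Proof.
rewrite -(sum_spectral_weight A X) rmorph_sum.
by apply: eq_bigr => k _; rewrite weightE.
Qed.

Lemma sum_weight_eigval : (\sum_k weight A X k * eigval X k)%:C = \tr B.
Proof.
rewrite -(trace_ratio B HK AE) -(sum_spectral_weight_diag A X0) rmorph_sum.
by apply: eq_bigr => k _; rewrite weightE // eigvalE // rmorphM.
Qed.

Lemma sum_weight_eigval2 : (\sum_k weight A X k * eigval X k ^+ 2)%:C = \tr (A *m X ^+ 2).
Proof.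
rewrite expr2 -mulmxE -(sum_spectral_weight_diag2 A X0) rmorph_sum.
by apply: eq_bigr => k _; rewrite weightE // eigvalE // rmorphM rmorphXn.
Qed.

Lemma sum_overlapr_l : (\sum_i \sum_j eigval A i * overlapr A B i j)%:C = \tr A.
Proof.
rewrite -(sum_overlap_l B A0) rmorph_sum; apply: eq_bigr => i _.
rewrite rmorph_sum; apply: eq_bigr => j _.
by rewrite overlaprE eigvalE // rmorphM.
Qed.

Lemma sum_overlapr_r : (\sum_i \sum_j eigval B j * overlapr A B i j)%:C = \tr B.
Proof.
rewrite -(sum_overlap_r A B0) rmorph_sum; apply: eq_bigr => i _.
rewrite rmorph_sum; apply: eq_bigr => j _.
by rewrite overlaprE eigvalE // rmorphM.
Qed.

Lemma resolvent_sum_le (t : R) : 0 < t ->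
  \sum_i \sum_j eigval A i * (eigval A i / (eigval B j + t * eigval A i)) * overlapr A B i j
    <= \sum_k weight A X k * (eigval X k + t)^-1.
Proof.
move=> t0; rewrite -lecR.
have tC : 0 < t%:C :> C by rewrite ltcR.
have := overlap_resolvent_le A0 Au B0 Bu tC Hh Kh HK AE.
congr (_ <= _); rewrite rmorph_sum; apply: eq_bigr => i _; last first.
  by rewrite weightE // eigvalE // rmorphM fmorphV rmorphD.
rewrite rmorph_sum; apply: eq_bigr => j _.
rewrite overlaprE !eigvalE //; move: (overlapr A B i j) (eigval A i) (eigval B j) => w a b.
by rewrite !rmorphM fmorphV rmorphD rmorphM.
Qed.

Lemma eigval_op_ratio_gt0 k : 0 < eigval X k.
Proof.
apply: eigval_gt0 => //.
have [_ Ku] := mulmx1_unit HK; rewrite /K in Ku.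
by rewrite /X /op_ratio 2!unitmx_mul Ku Bu.
Qed.

(* The two sides are the traces of A #_p B and A^(1-p) B^p, by
   [trace_op_natural] and [trace_op_pow2]. *)
Lemma trace_op_natural_le (p : R) : 0 < p -> p <= 1 ->
  \sum_k weight A X k * eigval X k `^ p
    <= \sum_i \sum_j eigval A i `^ (1 - p) * eigval B j `^ p * overlapr A B i j.
Proof.
move=> p0; have a0 i := eigval_gt0 i A0 Au; have b0 j := eigval_gt0 j B0 Bu.
have x0 := eigval_op_ratio_gt0.
(* The integral representation requires p < 1. At p = 1 both sides are Tr B. *)
rewrite le_eqVlt => /predU1P[->|p1].
  rewrite -lecR (eq_bigr (fun k => weight A X k * eigval X k)); last first.
    by move=> k _; rewrite powRr1 // ltW.
  rewrite sum_weight_eigval -sum_overlapr_r lecR; apply: ler_sum => i _.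
  by apply: ler_sum => j _; rewrite subrr powRr0 mul1r powRr1 // ltW.
rewrite pair_bigA /=.
(* Writing a^(1 - p) b^p as a (b / a)^p gives a power sum over pairs, at the points b_j / a_i. *)
rewrite [leRHS](eq_bigr (fun ij =>
    eigval A ij.1 * overlapr A B ij.1 ij.2 * (eigval B ij.2 / eigval A ij.1) `^ p)); last first.
  move=> [i j] _ /=; have ai := a0 i.
  rewrite powRM ?invr_ge0 ?(ltW (a0 _)) ?(ltW (b0 _)) //.
  rewrite -[(eigval A i)^-1]powR_inv1 ?(ltW ai) // -powRrM mulN1r powRN.
  rewrite powRB ?gt_eqF ?implybT // powRr1 ?(ltW ai) //.
  by ring.
apply: sum_powR_le_of_resolvent => //.
- by move=> k; exact: weight_ge0.
- by move=> ij; rewrite mulr_ge0 ?overlapr_ge0 // ltW.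
- by move=> ij; rewrite divr_gt0.
move=> t t0.
(* Since x / (x + t) = 1 - t / (x + t), and likewise at x = b / a below, the comparison reduces to
   equal masses Tr A and the reverse inequality between resolvents. *)
have -> : \sum_k weight A X k * (eigval X k / (eigval X k + t))
    = \sum_k weight A X k - t * \sum_k weight A X k * (eigval X k + t)^-1.
  rewrite mulr_sumr -sumrB; apply: eq_bigr => k _.
  move: (weight A X k) (eigval X k) (x0 k) => w x xk.
  by field; rewrite gt_eqF // addr_gt0.
have -> : \sum_ij eigval A ij.1 * overlapr A B ij.1 ij.2
      * (eigval B ij.2 / eigval A ij.1 / (eigval B ij.2 / eigval A ij.1 + t))
    = \sum_i \sum_j eigval A i * overlapr A B i j
      - t * \sum_i \sum_j
          eigval A i * (eigval A i / (eigval B j + t * eigval A i)) * overlapr A B i j.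
  rewrite !pair_bigA mulr_sumr -sumrB; apply: eq_bigr => -[i j] _ /=.
  move: (eigval A i) (eigval B j) (overlapr A B i j) (a0 i) (b0 j) => a b w ai bj.
  by field; rewrite !gt_eqF // addr_gt0 // mulr_gt0.
have -> : \sum_i \sum_j eigval A i * overlapr A B i j = \sum_k weight A X k.
  by apply: complexI; rewrite sum_overlapr_l sum_weight.
by rewrite lerD2l lerN2 ler_wpM2l ?resolvent_sum_le // ltW.
Qed.

End Pair.
End Operators.

(** * Bounds for the two Tsallis entropies *)

Theorem mainTheorem4 (R : realType) (n : nat) (rho sigma : 'M[R[i]]_n)
    (m M p : R) :
  density_op rho -> density_op sigma ->
  0 < m -> m < M ->
  loewner_le (m%:C *: rho) sigma -> loewner_le sigma (M%:C *: rho) ->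
  -1 <= p -> p <= 1 -> p != 0 ->
  [/\ ((1 - p) / 2 * (M `^ (p - 2) - m `^ (p - 2)) * (M + m - M * m))%:C
      + ((1 - p) / 2)%:C
        * ((m `^ (p - 2))%:C
           - (M `^ (p - 2))%:C * \tr (rho *m (op_ratio rho sigma) ^+ 2))
      <= \tr (tsallis_relative_op_entropy p rho sigma),
      \tr (tsallis_relative_op_entropy p rho sigma)
      <= ((1 - p) / 2 * (m `^ (p - 2) - M `^ (p - 2)) * (M + m - M * m))%:C
         + ((1 - p) / 2)%:C
           * ((M `^ (p - 2))%:C
              - (m `^ (p - 2))%:C * \tr (rho *m (op_ratio rho sigma) ^+ 2))
    & 0 < p ->
      tsallis_relative_entropy p rho sigma
      <= ((1 - p) / 2 * (m `^ (p - 2) - M `^ (p - 2)) * (M + m - M * m))%:C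
         + ((1 - p) / 2)%:C
           * ((M `^ (p - 2))%:C * \tr (rho *m (op_ratio rho sigma) ^+ 2)
              - (m `^ (p - 2))%:C)].
Proof.
move=> [[/positive_op_psdmx A0 Au] trA] [[/positive_op_psdmx B0 Bu] trB] m0 mM mAB BMA _ p1 pN0.
set X := op_ratio rho sigma.
have b0 k : 0 <= weight rho X k := weight_ge0 X k A0.
have xI k : m <= eigval X k <= M := eigval_op_ratio_itv A0 Au B0 k mAB BMA.
have s1 : \sum_k weight rho X k = 1 by apply: complexI; rewrite (sum_weight sigma A0) trA.
have sx : \sum_k weight rho X k * eigval X k = 1.
  by apply: complexI; rewrite (sum_weight_eigval A0 Au B0) trB.
have -> : \tr (tsallis_relative_op_entropy p rho sigma)
    = (p^-1 * (\sum_k weight rho X k * eigval X k `^ p - 1))%:C.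
  rewrite mxtraceZ mxtraceB (trace_op_natural _ _ A0 Au) trA.
  by rewrite rmorphM rmorphB rmorph1.
rewrite -(sum_weight_eigval2 A0 B0).
have /andP[lo up] := tsallis_bounds_sum m0 mM p1 pN0 b0 xI s1 sx.
split.
- by rewrite -!(rmorphM, rmorphB, rmorphD) lecR.
- by rewrite -!(rmorphM, rmorphB, rmorphD) lecR.
move=> p0; rewrite /tsallis_relative_entropy mxtraceB trA trace_op_pow2.
have := trace_op_natural_le A0 Au B0 Bu p0 p1; rewrite -/X.
set Q := \sum_i \sum_j _; set T := \sum_k _ * _ `^ p in lo *.
set S := \sum_k _ in lo * => TQ.
rewrite -(rmorph1 (real_complex R)) -rmorphB -fmorph_div.
rewrite -!(rmorphM, rmorphB, rmorphD) lecR.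
(* As [T] <= [Q] and 0 < p, the relative entropy (1 - Q) / p is at most (1 - T) / p, the negative of
   Tr T_p; the negated lower bound [lo] finishes. *)
apply: le_trans (_ : p^-1 * (1 - T) <= _).
  by rewrite mulrC ler_wpM2l ?invr_ge0 ?(ltW p0) // lerD2l lerN2.
rewrite -opprB mulrN lerNl; apply: le_trans lo; rewrite le_eqVlt; apply/orP; left.
by apply/eqP; ring.
Qed.
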